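(* Let $p$ be a prime, and let $(B,+,\circ)$ be a finite skew brace of order $p^n$. If either $(B,+)$ or $(B,\circ)$ is cyclic, then $B$ is a Dedekind skew brace. In particular, $B$ is centrally nilpotent.
   Context: A skew brace is a triple $(B,+,\circ)$ with $(B,+)$, $(B,\circ)$ (not necessarily abelian) groups such that $a\circ(b+c)=a\circ b-a+a\circ c$ for all $a,b,c\in B$. The identities of the two groups coincide and are denoted by $0$. For $a\in B$ put $\lambda_a(b)=-a+a\circ b$; then $\lambda:a\mapsto\lambda_a$ is a homomorphism $(B,\circ)\to\operatorname{Aut}(B,+)$. A sub-skew brace is a subset that is a subgroup of both $(B,+)$ and $(B,\circ)$. An ideal is a subgroup of $(B,+)$ that is normal in $(B,+)$, invariant under all $\lambda_b$, and normal in $(B,\circ)$; one can form the quotient skew brace $B/I$. $B$ is Dedekind if all its sub-skew braces are ideals of $B$. The centre is the ideal $Z(B)=\operatorname{Ker}(\lambda)\cap Z(B,+)\cap Z(B,\circ)$; the upper central series is $Z_0(B)=\{0\}$, $Z_{k+1}(B)/Z_k(B)=Z(B/Z_k(B))$; $B$ is centrally nilpotent if $B=Z_m(B)$ for some non-negative integer $m$. *)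

(* Defs.v *)
From HB Require Import structures.
From mathcomp Require Import all_boot all_order all_fingroup all_solvable.

Set Implicit Arguments.
Unset Strict Implicit.
Unset Printing Implicit Defensive.

Import GroupScope.

Declare Scope brace_scope.
Delimit Scope brace_scope with SB.

(* The two groups have independent identities sb_zero and sb_one; that they
   coincide is the lemma sb_oneE. *)
HB.mixin Record isSkewBrace B of Choice B := {
  sb_add : B -> B -> B;
  sb_zero : B;
  sb_opp : B -> B;
  sb_circ : B -> B -> B;
  sb_one : B;
  sb_inv : B -> B;
  sb_addA : associative sb_add;
  sb_add0 : left_id sb_zero sb_add;
  sb_addN : left_inverse sb_zero sb_opp sb_add;
  sb_circA : associative sb_circ;
  sb_circ1 : left_id sb_one sb_circ;
  sb_circV : left_inverse sb_one sb_inv sb_circ;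
  sb_circD : forall a b c,
    sb_circ a (sb_add b c)
    = sb_add (sb_add (sb_circ a b) (sb_opp a)) (sb_circ a c)
}.

#[short(type="skewBraceType")]
HB.structure Definition SkewBrace := {B of isSkewBrace B & Choice B}.

#[short(type="finSkewBraceType")]
HB.structure Definition FinSkewBrace := {B of SkewBrace B & Finite B}.

Notation "a + b" := (sb_add a b) : brace_scope.
Notation "- a" := (sb_opp a) : brace_scope.
Notation "a - b" := (sb_add a (sb_opp b)) : brace_scope.
Notation "a ∘ b" := (sb_circ a b) (at level 40, left associativity)
  : brace_scope.

Definition lam (B : skewBraceType) (a b : B) : B := (- a + a ∘ b)%SB.

(* Copies of B carrying the groups (B,+) and (B,∘), both written
   multiplicatively as MathComp's groups are.  The types {set B},
   {set addg B} and {set circg B} are convertible. *)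
Definition addg (B : Type) : Type := B.
Definition circg (B : Type) : Type := B.

HB.instance Definition _ (B : finSkewBraceType) := Finite.on (addg B).
HB.instance Definition _ (B : finSkewBraceType) :=
  Finite_isGroup.Build (addg B) (@sb_addA B) (@sb_add0 B) (@sb_addN B).
HB.instance Definition _ (B : finSkewBraceType) := Finite.on (circg B).
HB.instance Definition _ (B : finSkewBraceType) :=
  Finite_isGroup.Build (circg B) (@sb_circA B) (@sb_circ1 B) (@sb_circV B).

Definition addset (B : finSkewBraceType) (A : {set B}) : {set addg B} := A.
Definition circset (B : finSkewBraceType) (A : {set B}) : {set circg B} := A.

Section SubStructures.
Variable B : finSkewBraceType.
Implicit Types A I : {set B}.

Definition is_subskewbrace A :=
  group_set (addset A) && group_set (circset A).

Definition is_ideal I :=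
  [&& group_set (addset I) && (addset I <| [set: addg B]),
      [forall b : B, [forall a in I, lam b a \in I]]
    & group_set (circset I) && (circset I <| [set: circg B])].

Definition is_dedekind := forall A, is_subskewbrace A -> is_ideal A.

Definition ker_lam : {set B} := [set a | [forall b, lam a b == b]].

Definition centre : {set B} :=
  ker_lam :&: 'Z([set: addg B]) :&: 'Z([set: circg B]).

End SubStructures.

Record ideal (B : finSkewBraceType) := Ideal {
  ideal_set :> {set B};
  idealP : is_ideal ideal_set
}.

Section Theory.
Variable B : finSkewBraceType.
Implicit Types (a b c : B) (I : {set B}).

Lemma sb_addKr a b : (- a + (a + b))%SB = b.
Proof. exact: (@mulKg (addg B) a b). Qed.

Lemma sb_addVKr a b : (a + (- a + b))%SB = b.
Proof. exact: (@mulKVg (addg B) a b). Qed.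

Lemma sb_addr0 a : (a + sb_zero)%SB = a.
Proof. exact: (@mulg1 (addg B) a). Qed.

Lemma sb_addrN a : (a - a)%SB = sb_zero.
Proof. exact: (@mulgV (addg B) a). Qed.

Lemma sb_circKr a b : (sb_inv a ∘ (a ∘ b))%SB = b.
Proof. exact: (@mulKg (circg B) a b). Qed.

Lemma sb_circVKr a b : (a ∘ (sb_inv a ∘ b))%SB = b.
Proof. exact: (@mulKVg (circg B) a b). Qed.

Lemma sb_circr1 a : (a ∘ sb_one)%SB = a.
Proof. exact: (@mulg1 (circg B) a). Qed.

Lemma sb_addIl a b c : (a + b = a + c)%SB -> b = c.
Proof. by move/(congr1 (sb_add (- a)%SB)); rewrite !sb_addKr. Qed.

Lemma sb_circ_lam a b : (a ∘ b)%SB = (a + lam a b)%SB.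
Proof. by rewrite /lam sb_addVKr. Qed.

Lemma lamD a b c : lam a (b + c)%SB = (lam a b + lam a c)%SB.
Proof. by rewrite /lam sb_circD !sb_addA. Qed.

Lemma lam0 a : lam a sb_zero = sb_zero.
Proof. by apply: (@sb_addIl (lam a sb_zero)); rewrite -lamD sb_add0 sb_addr0. Qed.

Lemma sb_oneE : sb_one = sb_zero :> B.
Proof. by rewrite -[RHS]sb_circ1 sb_circ_lam lam0 sb_addr0. Qed.

Lemma lam_one b : lam sb_one b = b.
Proof. by rewrite /lam sb_circ1 sb_oneE -{1}(sb_add0 b) sb_addKr. Qed.

Lemma lam_circ a b c : lam (a ∘ b)%SB c = lam a (lam b c).
Proof.
apply: (@sb_addIl (a ∘ b)%SB); rewrite -sb_circ_lam -sb_circA (sb_circ_lam b c).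
by rewrite sb_circ_lam lamD sb_addA -sb_circ_lam.
Qed.

Lemma is_idealP I : reflect
  [/\ sb_zero \in I, forall a b, a \in I -> b \in I -> (a + b)%SB \in I,
      forall a b, a \in I -> (- b + (a + b))%SB \in I,
      forall a b, a \in I -> lam b a \in I
    & forall a b, a \in I -> (sb_inv b ∘ (a ∘ b))%SB \in I] (is_ideal I).
Proof.
apply: (iffP and3P) => [[]|[I0 ID IJ Il IC]].
  case/andP=> /group_setP[I0 ID] /andP[_ /subsetP nI] /forallP Il.
  case/andP=> _ /andP[_ /subsetP nC]; split=> [|a b|a b aI|a b aI|a b aI] //.
  - exact: ID.
  - by rewrite -(memJ_norm _ (nI b (in_setT _))) in aI.
  - by move/forallP/(_ a): (Il b); rewrite aI.
  - by rewrite -(memJ_norm _ (nC b (in_setT _))) in aI.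
split.
- apply/andP; split; first by apply/group_setP; split=> // a b; apply: ID.
  apply/andP; split; first exact: subsetT.
  apply/subsetP=> b _; rewrite inE; apply/subsetP=> _ /imsetP[a aI ->].
  exact: IJ.
- by apply/forallP=> b; apply/forallP=> a; apply/implyP; apply: Il.
apply/andP; split.
  apply/group_setP; split=> [|a b aI bI]; first by rewrite /= -[1]/sb_one sb_oneE.
  by rewrite -[_ * _]/(_ ∘ _)%SB sb_circ_lam; apply: ID => //; apply: Il.
apply/andP; split; first exact: subsetT.
apply/subsetP=> b _; rewrite inE; apply/subsetP=> _ /imsetP[a aI ->].
exact: IC.
Qed.

Lemma centreP a : reflect
  [/\ forall b, lam a b = b, forall b, (a + b = b + a)%SB
    & forall b, (a ∘ b = b ∘ a)%SB] (a \in centre B).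
Proof.
rewrite !inE; apply: (iffP idP).
  case/andP=> /andP[/forallP La /centP Za] /centP Ca.
  split=> b; first exact/eqP; first exact/Za/in_setT.
  exact/Ca/in_setT.
case=> La Za Ca; apply/andP; split; first (apply/andP; split).
- by apply/forallP=> b; apply/eqP.
- by apply/centP=> b _; apply: Za.
- by apply/centP=> b _; apply: Ca.
Qed.

Lemma centre_is_ideal : is_ideal (centre B).
Proof.
have lamE a b : a \in centre B -> lam b a = a.
  by case/centreP=> La Za Ca; rewrite /lam -Ca sb_circ_lam La Za sb_addKr.
have addE a b : a \in centre B -> (a + b = a ∘ b)%SB.
  by case/centreP=> La _ _; rewrite sb_circ_lam La.
apply/is_idealP; split=> [|a b aZ bZ|a b aZ|a b aZ|a b aZ].
- apply/centreP; split=> b; first by rewrite -sb_oneE lam_one.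
    by rewrite sb_add0 sb_addr0.
  by rewrite -sb_oneE sb_circ1 sb_circr1.
- have [La Za Ca] := centreP _ aZ; have [Lb Zb Cb] := centreP _ bZ.
  apply/centreP; split=> c.
  + by rewrite addE // lam_circ Lb La.
  + by rewrite -sb_addA Zb sb_addA Za sb_addA.
  + by rewrite addE // -sb_circA Cb sb_circA Ca sb_circA.
- by have [_ Za _] := centreP _ aZ; rewrite Za sb_addKr.
- by rewrite lamE.
- by have [_ _ Ca] := centreP _ aZ; rewrite Ca sb_circKr.
Qed.

Lemma zero_is_ideal : is_ideal [set sb_zero : B].
Proof.
apply/is_idealP; split=> [|a b|a b|a b|a b]; rewrite ?inE //.
- by move=> /eqP-> /eqP->; rewrite sb_add0.
- by move/eqP->; rewrite sb_add0 sb_addN.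
- by move/eqP->; rewrite lam0.
- by move/eqP->; rewrite -{1}sb_oneE sb_circ1 sb_circV sb_oneE.
Qed.

Definition zero_ideal : ideal B := Ideal zero_is_ideal.

End Theory.

(* B/I: its carrier and its addition are those of the quotient group
   (B,+)/(I,+), and (I + a) ∘ (I + b) = I + a ∘ b; see quo_projC. *)
Definition quo (B : finSkewBraceType) (I : ideal B) : Type :=
  coset_of (addset I).
HB.instance Definition _ (B : finSkewBraceType) (I : ideal B) :=
  Finite.on (quo I).

Section Quotient.
Variables (B : finSkewBraceType) (I : ideal B).
Implicit Types (a b c : B) (x y z : quo I).

Definition quo_proj a : quo I := coset (addset I) a.

Definition quo_add x y : quo I := (x : coset_of _) * (y : coset_of _).
Definition quo_zero : quo I := (1 : coset_of (addset I)).
Definition quo_opp x : quo I := (x : coset_of _)^-1.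
Definition quo_circ x y : quo I :=
  quo_proj ((repr x : B) ∘ (repr y : B))%SB.
Definition quo_one : quo I := quo_proj sb_one.
Definition quo_inv x : quo I := quo_proj (sb_inv (repr x : B)).

Lemma ideal_addgroup_set : group_set (addset I).
Proof. by case/and3P: (idealP I) => /andP[]. Qed.
Canonical ideal_addgroup := Group ideal_addgroup_set.

Lemma ideal_addnorm (a : addg B) : a \in 'N(addset I).
Proof.
by case/and3P: (idealP I) => /andP[_ /andP[_ /subsetP nI]] _ _; apply/nI/in_setT.
Qed.

Lemma quo_proj_repr x : quo_proj (repr x : addg B) = x.
Proof. exact: coset_reprK. Qed.

Lemma quo_projD a b : quo_proj (a + b)%SB = quo_add (quo_proj a) (quo_proj b).
Proof. by apply: (@morphM _ _ _ (coset_morphism (addset I))); apply: ideal_addnorm. Qed.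

Lemma quo_projN a : quo_proj (- a)%SB = quo_opp (quo_proj a).
Proof. by apply: (@morphV _ _ _ (coset_morphism (addset I))); apply: ideal_addnorm. Qed.

Lemma quo_projP a b :
  quo_proj a = quo_proj b <-> exists2 i, i \in (I : {set B}) & b = (a ∘ i)%SB.
Proof.
have [I0 ID IJ Il IC] := is_idealP _ (idealP I); split.
  move=> Eab; have: ((- a + b)%SB : addg B) \in addset I.
    apply: coset_idr; first exact: ideal_addnorm.
    change (quo_proj (- a + b)%SB = quo_zero).
    by rewrite quo_projD quo_projN Eab /quo_add mulVg.
  exists (lam (sb_inv a) (- a + b)%SB); first exact: Il.
  rewrite sb_circ_lam -lam_circ.
  rewrite -[(a ∘ sb_inv a)%SB]/((a : circg B) * (a : circg B)^-1) mulgV.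
  by rewrite lam_one sb_addVKr.
case=> i iI ->; rewrite sb_circ_lam quo_projD.
have ->: quo_proj (lam a i) = quo_zero by apply: coset_id; apply: Il.
by rewrite /quo_add mulg1.
Qed.

Lemma quo_projC a b :
  quo_proj (a ∘ b)%SB = quo_circ (quo_proj a) (quo_proj b).
Proof.
have [I0 ID IJ Il IC] := is_idealP _ (idealP I).
rewrite /quo_circ; set a' := repr _; set b' := repr _.
have /quo_projP[i iI ->]: quo_proj a = quo_proj a' by rewrite quo_proj_repr.
have /quo_projP[j jI ->]: quo_proj b = quo_proj b' by rewrite quo_proj_repr.
apply/quo_projP; exists ((sb_inv b ∘ (i ∘ b)) ∘ j)%SB.
  by rewrite sb_circ_lam; apply: ID; [apply: IC | apply: Il].
by rewrite -!sb_circA; congr (a ∘ _)%SB; rewrite sb_circVKr.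
Qed.

Lemma quo_projS x : {a | x = quo_proj a}.
Proof. by exists (repr x : addg B); rewrite quo_proj_repr. Qed.

Lemma quo_circA : associative quo_circ.
Proof.
move=> x y z; have [a ->] := quo_projS x; have [b ->] := quo_projS y.
by have [c ->] := quo_projS z; rewrite -!quo_projC sb_circA.
Qed.

Lemma quo_circ1 : left_id quo_one quo_circ.
Proof.
by move=> x; have [a ->] := quo_projS x; rewrite /quo_one -quo_projC sb_circ1.
Qed.

Lemma quo_circV : left_inverse quo_one quo_inv quo_circ.
Proof.
by move=> x; rewrite /quo_inv -{2}[x]quo_proj_repr -quo_projC sb_circV.
Qed.

Lemma quo_circD x y z : quo_circ x (quo_add y z) =
  quo_add (quo_add (quo_circ x y) (quo_opp x)) (quo_circ x z).
Proof.
have [a ->] := quo_projS x; have [b ->] := quo_projS y.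
have [c ->] := quo_projS z.
by rewrite -quo_projD -!quo_projC -quo_projN -!quo_projD sb_circD.
Qed.

HB.instance Definition _ := isSkewBrace.Build (quo I)
  (@mulgA (coset_of (addset I))) (@mul1g (coset_of (addset I)))
  (@mulVg (coset_of (addset I))) quo_circA quo_circ1 quo_circV quo_circD.

Lemma preim_is_ideal (J : {set quo I}) :
  is_ideal J -> is_ideal [set a | quo_proj a \in J].
Proof.
case/is_idealP=> J0 JD JJ Jl JC.
have projV b : quo_proj (sb_inv b) = sb_inv (quo_proj b).
  have VC : (quo_proj (sb_inv b) ∘ quo_proj b)%SB = sb_one :> quo I.
    by rewrite -[LHS]quo_projC sb_circV.
  rewrite -[RHS]sb_circ1 -VC -sb_circA.
  by rewrite -(sb_circr1 (sb_inv (quo_proj b))) sb_circVKr sb_circr1.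
apply/is_idealP; split=> [|a b|a b|a b|a b]; rewrite !inE.
- suff ->: quo_proj sb_zero = sb_zero by [].
  exact: (@morph1 _ _ _ (coset_morphism (addset I))).
- by move=> aJ bJ; rewrite quo_projD; apply: JD.
- by move=> aJ; rewrite !quo_projD quo_projN; apply: JJ.
- by move=> aJ; rewrite quo_projD quo_projN quo_projC; apply: Jl.
- by move=> aJ; rewrite !quo_projC projV; apply: JC.
Qed.

Definition preim_ideal (J : ideal (quo I)) : ideal B :=
  Ideal (preim_is_ideal (idealP J)).

End Quotient.

Section UpperCentralSeries.
Variable B : finSkewBraceType.

Definition centre_ideal (C : finSkewBraceType) : ideal C :=
  Ideal (centre_is_ideal C).

(* Z_(k+1) is the full preimage in B of the centre of B / Z_k. *)
Fixpoint upper_central (k : nat) : ideal B :=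
  if k is k'.+1 then preim_ideal (centre_ideal (quo (upper_central k')))
  else zero_ideal B.

Definition centrally_nilpotent :=
  exists m : nat, ideal_set (upper_central m) = [set: B].

End UpperCentralSeries.

(* Main.v *)
Require Import Defs.
From mathcomp Require Import all_boot all_order all_fingroup all_solvable.

Set Implicit Arguments.
Unset Strict Implicit.
Unset Printing Implicit Defensive.

Import GroupScope.

(** Call a skew brace B of p-power order one-sided cyclic if (B,+) or (B,∘) is
    cyclic. Such braces are closed under quotients, so both claims reduce to
    statements about B / Z(B) and the B / Z_k(B) once [centre_neq0] shows that Z(B) is nontrivial
    when B is.

    For the centre, let the p-group (B,∘) act on B through lam. By orbit
    counting ([lam_fixed_point]), every lam-stable subset that contains 0 and
    has order divisible by p contains a nonzero fixed point of lam.
    - If (B,+) is cyclic with generator g, an automorphism of (B,+) is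
      determined by its value at g, and this value is never 0. Hence
      a |-> lam a is not injective and Ker(lam) is nontrivial
      ([ker_lam_neq0]). As + is commutative, Ker(lam) is lam-stable
      ([ker_lam_stable]); a nonzero fixed point in it is central.
    - If (B,∘) is cyclic, take a nonzero fixed point a in the centre of (B,+),
      a nontrivial characteristic subgroup. Since a is fixed,
      b ∘ a = b + a = a + b, while a ∘ b = a + lam a b; commutativity of ∘
      gives lam a b = b, so a is central.

    The subgroups of a cyclic p-group form a chain, so a sub-skew brace S is
    comparable with Z(B). If S is contained in Z(B), it is an ideal because all
    operations of B are trivial on central elements ([sub_centre_ideal]). If S
    contains Z(B), then S is the preimage of its image in B / Z(B), which is an
    ideal by induction ([ideal_of_quo]). Central nilpotency holds because
    Z_(k+1) is strictly larger than Z_k until the whole of B is reached. *)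

(** * Group-theoretic preliminaries *)

Section SurjectiveMorphism.
Variables (gT rT : finGroupType) (f : gT -> rT).
Hypotheses (fM : {morph f : x y / x * y}) (f_surj : forall y, exists x, y = f x).

Let fM_in : {in [set: gT] &, {morph f : x y / x * y}}.
Proof. by move=> x y _ _; apply: fM. Qed.

Let morphism_f := Morphism fM_in.

Let morphim_f : morphism_f @* [set: gT] = [set: rT].
Proof.
apply/setP=> y; rewrite inE; have [x ->] := f_surj y.
by apply: (mem_morphim morphism_f); rewrite inE.
Qed.

Lemma cyclic_surj : cyclic [set: gT] -> cyclic [set: rT].
Proof. by move=> cG; rewrite -morphim_f; apply: morphim_cyclic. Qed.

Lemma card_surj_dvdn : #|rT| %| #|gT|.
Proof.
rewrite -!cardsT -morphim_f.
exact: (@dvdn_morphim _ _ _ morphism_f [group of [set: gT]]).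
Qed.

End SurjectiveMorphism.

(** In a cyclic group inclusion of subgroups is divisibility of orders, which
    is total on powers of p. *)
Lemma cyclic_pgroup_chain (gT : finGroupType) (p : nat) (G H K : {group gT}) :
  cyclic G -> p.-group G -> H \subset G -> K \subset G ->
  (H \subset K) || (K \subset H).
Proof.
move=> cG pG sHG sKG; rewrite -(cardSg_cyclic cG sHG sKG).
rewrite -(cardSg_cyclic cG sKG sHG).
have [i ->] := p_natP (pgroupS sHG pG); have [j ->] := p_natP (pgroupS sKG pG).
by case/orP: (leq_total i j) => /(dvdn_exp2l p) ->; rewrite ?orbT.
Qed.

(** * The centre is nontrivial *)

Section Centre.
Variable B : finSkewBraceType.
Implicit Types (a b : B) (S : {set B}).

Lemma lamK a : cancel (@lam B a) (lam (sb_inv a)).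
Proof. by move=> b; rewrite -lam_circ sb_circV lam_one. Qed.

Lemma lamVK a : cancel (@lam B (sb_inv a)) (lam a).
Proof.
move=> b; rewrite -lam_circ.
rewrite -[(a ∘ sb_inv a)%SB]/((a : circg B) * (a : circg B)^-1) mulgV.
exact: lam_one.
Qed.

(** The left action lam of (B,∘) turned into a right action, the form that
    the orbit-counting results expect. *)
Definition lam_act (x : B) (a : circg B) : B := lam (a^-1 : B) x.

Lemma lam_act1 x : lam_act x 1 = x.
Proof. by rewrite /lam_act invg1; apply: lam_one. Qed.

Lemma lam_actM x : act_morph lam_act x.
Proof. by move=> a b; rewrite /lam_act invMg; apply: lam_circ. Qed.

Definition lam_action := TotalAction lam_act1 lam_actM.

(** Orbit counting: the number of fixed points of the p-group (B,∘) on S is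
    divisible by p, and 0 is one of them. *)
Lemma lam_fixed_point (p : nat) S :
  prime p -> p.-nat #|B| -> (forall a b, a \in S -> lam b a \in S) ->
  sb_zero \in S -> p %| #|S| ->
  exists2 a, a \in S & a != sb_zero /\ forall b, lam b a = a.
Proof.
move=> p_pr pB Slam S0 p_dv_S.
have pG : p.-group [set: circg B] by rewrite /pgroup cardsT.
have actS : [acts [set: circg B], on S | lam_action].
  apply/actsP=> c _ x; apply/idP/idP; last exact: Slam.
  by move/(Slam _ (c : B)); rewrite /= /lam_act lamVK.
have /eqP := pgroup_fix_mod pG actS.
rewrite eqn_mod_dvd ?subset_leq_card ?subsetIl //.
rewrite dvdn_subr ?subset_leq_card ?subsetIl // => p_dv_F.
set F := 'Fix_(S | _)(_) in p_dv_F.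
have FP a : reflect (a \in S /\ forall b, lam b a = a) (a \in F).
  rewrite inE; apply: (iffP andP) => -[aS /= fixa]; split=> //.
    move=> b; move/afixP/(_ ((b : circg B)^-1)): fixa => /(_ (in_setT _)).
    by rewrite /= /lam_act invgK.
  by apply/afixP=> b _; apply: fixa.
have F0 : sb_zero \in F by apply/FP; split=> // b; apply: lam0.
have : 1 < #|F|.
  apply: leq_trans (prime_gt1 p_pr) (dvdn_leq _ p_dv_F).
  by apply/card_gt0P; exists sb_zero.
rewrite (cardsD1 sb_zero) F0 ltnS => /card_gt0P[a /setD1P[a0 /FP[aS fixa]]].
by exists a.
Qed.

Lemma fixed_circ_add a b :
  (forall c, (a + c = c + a)%SB) -> (forall c, lam c a = a) ->
  (b ∘ a = a + b)%SB.
Proof. by move=> Za fixa; rewrite sb_circ_lam fixa Za. Qed.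

Lemma centre_fixed_ker a :
  (forall b, (a + b = b + a)%SB) -> (forall b, lam b a = a) ->
  (forall b, lam a b = b) -> a \in centre B.
Proof.
move=> Za fixa kera; apply/centreP; split=> // b.
by rewrite sb_circ_lam kera fixed_circ_add.
Qed.

Lemma centre_fixed_comm a :
  (forall b, (a + b = b + a)%SB) -> (forall b, lam b a = a) ->
  (forall b, (a ∘ b = b ∘ a)%SB) -> a \in centre B.
Proof.
move=> Za fixa Ca; apply/centreP; split=> // b.
by apply: (@sb_addIl _ a); rewrite -sb_circ_lam Ca fixed_circ_add.
Qed.

Lemma ker_lamP a : reflect (forall b, lam a b = b) (a \in ker_lam B).
Proof. by rewrite inE; apply: (iffP forallP) => Ka b; apply/eqP. Qed.

Lemma ker_lam_group_set : group_set (circset (ker_lam B)).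
Proof.
apply/group_setP; split=> [|a b]; first by apply/ker_lamP=> b; apply: lam_one.
move=> /ker_lamP Ka /ker_lamP Kb; apply/ker_lamP=> c.
by rewrite -[a * b]/(a ∘ b)%SB lam_circ Kb Ka.
Qed.

(** When + commutes, lam b a is the ∘-conjugate of a by b, and Ker(lam) is
    normal in (B,∘). *)
Lemma ker_lam_stable a b :
  commutative (@sb_add B) -> a \in ker_lam B -> lam b a \in ker_lam B.
Proof.
move=> addC /ker_lamP Ka; set d := ((b ∘ a) ∘ sb_inv b)%SB.
have Kd c : lam d c = c by rewrite /d !lam_circ Ka lamVK.
suff <- : d = lam b a by apply/ker_lamP.
(* b + d = d + b = d ∘ b, as lam d is the identity, and d ∘ b = b ∘ a. *)
apply: (@sb_addIl _ b); rewrite -sb_circ_lam addC -[b in LHS]Kd -sb_circ_lam.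
by rewrite /d -sb_circA sb_circV sb_circr1.
Qed.

(** Pigeonhole: for a generator g, the map a |-> lam a g misses 0, so two
    distinct elements a and b give automorphisms that agree at g, hence
    everywhere, and the ∘-quotient of a by b is a nonzero element of the
    kernel. *)
Lemma ker_lam_neq0 :
  cyclic [set: addg B] -> 1 < #|B| ->
  exists2 a, a \in ker_lam B & a != sb_zero.
Proof.
case/cyclicP=> g defB B_gt1.
have lam_inj_g a b : lam a (g : B) = lam b (g : B) -> lam a =1 lam b.
  move=> eq_g x; have /cycleP[k ->] : (x : addg B) \in <[g]>.
    by rewrite -defB inE.
  elim: k => [|k IHk]; first by rewrite !lam0.
  by rewrite expgS -[_ * _]/((g : B) + (g ^+ k : addg B))%SB !lamD eq_g IHk.
have : ~~ injectiveb (fun a : B => lam a (g : B)).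
  apply/negP=> /injectiveP inj_g.
  have /codomP[a] : sb_zero \in codom (fun a : B => lam a (g : B)).
    exact: (inj_card_onto inj_g).
  move=> /(congr1 (lam (sb_inv a))); rewrite lamK lam0 => g0.
  by move: B_gt1; rewrite -cardsT -[#|_|]/#|[set: addg B]| defB -g0 cycle1 cards1.
case/injectivePn=> a [b neq_ab eq_ab]; exists (sb_inv b ∘ a)%SB.
  by apply/ker_lamP=> c; rewrite lam_circ (lam_inj_g _ _ eq_ab) lamK.
apply: contraNneq neq_ab => /(congr1 (sb_circ b)).
by rewrite sb_circVKr -sb_oneE sb_circr1 => ->.
Qed.

End Centre.

(** The hypothesis on B in a form stable under quotients, which is what allows
    [centre_neq0] to be used in B / Z(B) and in every B / Z_k(B). *)
Definition one_cyclic (B : finSkewBraceType) :=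
  cyclic [set: addg B] \/ cyclic [set: circg B].

(** A nonzero lam-fixed point is found in Ker(lam) if (B,+) is cyclic, and in
    the centre of (B,+) if (B,∘) is. *)
Lemma centre_neq0 (p : nat) (B : finSkewBraceType) :
  prime p -> p.-nat #|B| -> one_cyclic B -> 1 < #|B| ->
  exists2 a, a \in centre B & a != sb_zero.
Proof.
move=> p_pr pB cB B_gt1; case: cB => [cA|cC].
  have addC : commutative (@sb_add B).
    by move=> a b; apply: (centsP (cyclic_abelian cA)); rewrite inE.
  have [k Kk k0] := ker_lam_neq0 cA B_gt1.
  pose K := Group (ker_lam_group_set B).
  have pK : p.-group K by apply: (pgroupS (subsetT _)); rewrite /pgroup cardsT.
  have ntK : K :!=: 1.
    apply/trivgPn; exists (k : circg B) => //.
    by apply: contraNneq k0 => ->; rewrite -sb_oneE.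
  have [_ p_dv_K _] := pgroup_pdiv pK ntK.
  have K0 : sb_zero \in ker_lam B by rewrite -sb_oneE; apply: (group1 K).
  have [a /ker_lamP Ka [a0 fixa]] :=
    lam_fixed_point p_pr pB (fun a b => @ker_lam_stable B a b addC) K0 p_dv_K.
  by exists a => //; apply: centre_fixed_ker.
have circC (a b : B) : (a ∘ b = b ∘ a)%SB.
  by apply: (centsP (cyclic_abelian cC)); rewrite inE.
pose Z : {set B} := 'Z([set: addg B]).
have ZP (a : B) : reflect (forall b, (a + b = b + a)%SB) (a \in Z).
  rewrite inE [_ \in setT]in_setT; apply: (iffP centP) => [Za b|Za b _].
    by apply: Za; rewrite inE.
  exact: Za.
have Zlam a b : a \in Z -> lam b a \in Z.
  move/ZP=> Za; apply/ZP=> c.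
  by rewrite -(lamVK b c) -!lamD Za.
have pA : p.-group [set: addg B] by rewrite /pgroup cardsT.
have ntZ : 'Z([set: addg B]) != 1.
  rewrite center_nil_eq1 ?(pgroup_nil pA) // -cardG_gt1 cardsT //.
have [_ p_dv_Z _] := pgroup_pdiv (pgroupS (center_sub _) pA) ntZ.
have Z0 : sb_zero \in Z by apply: (group1 'Z([set: addg B])).
have [a /ZP Za [a0 fixa]] := lam_fixed_point p_pr pB Zlam Z0 p_dv_Z.
by exists a => //; apply: centre_fixed_comm.
Qed.

(** * Sub-skew braces, ideals and quotients *)

Lemma one_cyclic_quo (B : finSkewBraceType) (I : ideal B) :
  one_cyclic B -> one_cyclic (quo I).
Proof.
have surj (x : quo I) : exists a : B, x = quo_proj I a.
  by have [a ->] := quo_projS x; exists a.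
case=> c; [left | right].
  exact: (@cyclic_surj (addg B) (addg (quo I)) _ (quo_projD I) surj c).
exact: (@cyclic_surj (circg B) (circg (quo I)) _ (quo_projC I) surj c).
Qed.

Lemma pnat_quo (p : nat) (B : finSkewBraceType) (I : ideal B) :
  p.-nat #|B| -> p.-nat #|{: quo I}|.
Proof.
apply: pnat_dvd.
apply: (@card_surj_dvdn (addg B) (addg (quo I)) _ (quo_projD I)) => x.
by have [a ->] := quo_projS x; exists a.
Qed.

Lemma quo_proj_eq0 (B : finSkewBraceType) (I : ideal B) (a : B) :
  quo_proj I a = sb_zero -> a \in ideal_set I.
Proof.
by apply: (@coset_idr _ (ideal_addgroup I) a); apply: ideal_addnorm.
Qed.

Lemma card_quo_lt (B : finSkewBraceType) (I : ideal B) (a : B) :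
  a \in ideal_set I -> a != sb_zero -> #|{: quo I}| < #|B|.
Proof.
move=> aI a0.
have -> : #|{: quo I}| = #|[set: addg B] / addset I|.
  rewrite -cardsT; apply: eq_card => x; rewrite in_setT.
  have [b ->] := quo_projS x; symmetry; apply/idP.
  by apply: mem_quotient; rewrite inE.
have -> : #|B| = #|[set: addg B]| by rewrite cardsT.
apply: (@ltn_quotient _ (ideal_addgroup I)); last exact: subsetT.
by apply/trivgPn; exists (a : addg B).
Qed.

(** Central elements are fixed by both conjugations and by lam, so closure
    under + suffices. *)
Lemma sub_centre_ideal (B : finSkewBraceType) (S : {set B}) :
  is_subskewbrace S -> S \subset centre B -> is_ideal S.
Proof.
case/andP=> /group_setP[S0 SD] _ /subsetP sSZ.
apply/is_idealP; split=> // [a b|a b|a b] aS;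
  have [La Za Ca] := centreP _ (sSZ _ aS).
- by rewrite Za sb_addKr.
- by rewrite /lam -Ca sb_circ_lam La Za sb_addKr.
- by rewrite Ca sb_circKr.
Qed.

Lemma subskewbrace_quo (B : finSkewBraceType) (I : ideal B) (S : {set B}) :
  is_subskewbrace S -> is_subskewbrace (quo_proj I @: S).
Proof.
case/andP=> /group_setP[S0 SD] /group_setP[S1 SC].
apply/andP; split; apply/group_setP; split.
- apply/imsetP; exists sb_zero => //; symmetry.
  exact: (@morph1 _ _ _ (coset_morphism (addset I))).
- move=> _ _ /imsetP[a aS ->] /imsetP[b bS ->].
  by rewrite -[_ * _]/(quo_add _ _) -quo_projD imset_f // SD.
- exact: (imset_f _ S1).
- move=> _ _ /imsetP[a aS ->] /imsetP[b bS ->].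
  by rewrite -[_ * _]/(quo_circ _ _) -quo_projC imset_f // SC.
Qed.

(** As S contains I, it is a union of cosets of I, hence the full preimage of
    its image in B / I; preimages of ideals are ideals. *)
Lemma ideal_of_quo (B : finSkewBraceType) (I : ideal B) (S : {set B}) :
  is_subskewbrace S -> ideal_set I \subset S ->
  is_ideal (quo_proj I @: S) -> is_ideal S.
Proof.
case/andP=> _ /group_setP[_ SC] /subsetP sIS /preim_is_ideal.
suff -> : [set a | quo_proj I a \in quo_proj I @: S] = S by [].
apply/setP=> a; rewrite inE; apply/imsetP/idP => [[s sS]|aS]; last by exists a.
by move=> /esym/quo_projP[i iI ->]; apply: SC => //; apply: sIS.
Qed.

Lemma subskewbrace_chain (p : nat) (B : finSkewBraceType) (S T : {set B}) :
  p.-nat #|B| -> one_cyclic B -> is_subskewbrace S -> is_subskewbrace T ->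
  (S \subset T) || (T \subset S).
Proof.
move=> pB cB /andP[gSA gSC] /andP[gTA gTC].
case: cB => [c|c].
  apply: (cyclic_pgroup_chain (H := Group gSA) (K := Group gTA) c); last 2 first.
  - exact: subsetT.
  - exact: subsetT.
  by rewrite /pgroup cardsT; apply: pB.
apply: (cyclic_pgroup_chain (H := Group gSC) (K := Group gTC) c); last 2 first.
- exact: subsetT.
- exact: subsetT.
by rewrite /pgroup cardsT; apply: pB.
Qed.

Lemma ideal_is_subskewbrace (B : finSkewBraceType) (I : {set B}) :
  is_ideal I -> is_subskewbrace I.
Proof. by case/and3P=> /andP[gA _] _ /andP[gC _]; apply/andP. Qed.

(** * Dedekind property and central nilpotency *)

(** A sub-skew brace not inside Z(B) contains it by the chain property, and so
    comes from B / Z(B), whose order is smaller because Z(B) is nontrivial. *)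
Lemma one_cyclic_dedekind (p : nat) (B : finSkewBraceType) :
  prime p -> p.-nat #|B| -> one_cyclic B -> is_dedekind B.
Proof.
move=> p_pr; have [m] := ubnP #|B|; elim: m => // m IHm in B *.
rewrite ltnS => leBm pB cB S subS.
have subZ := ideal_is_subskewbrace (centre_is_ideal B).
have [sSZ|nsSZ] := boolP (S \subset centre B); first exact: sub_centre_ideal.
have sZS : centre B \subset S.
  by have := subskewbrace_chain pB cB subS subZ; rewrite (negPf nsSZ).
have B_gt1 : 1 < #|B|.
  case/subsetPn: nsSZ => a _ aZ.
  have zZ : sb_zero \in centre B by case/is_idealP: (centre_is_ideal B).
  apply/card_gt1P; exists a, sb_zero; split=> //.
  by apply: contraNneq aZ => ->.
have [a aZ a0] := centre_neq0 p_pr pB cB B_gt1.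
apply: (@ideal_of_quo _ (centre_ideal B)) => //.
apply: IHm; last exact: subskewbrace_quo.
- by apply: leq_trans leBm; apply: (@card_quo_lt _ (centre_ideal B)) aZ a0.
- exact: pnat_quo.
- exact: one_cyclic_quo.
Qed.

Lemma upper_central_sub (B : finSkewBraceType) k :
  upper_central B k \subset upper_central B k.+1.
Proof.
apply/subsetP=> a aZ /=; rewrite inE.
have -> : quo_proj (upper_central B k) a = sb_zero by apply: coset_id.
by case/is_idealP: (centre_is_ideal (quo (upper_central B k))).
Qed.

(** A nonzero central element of B / Z_k makes Z_(k+1) strictly larger than
    Z_k, so Z_(k+1) has more than k elements as long as Z_k is proper, which
    fails at k = |B|. *)
Lemma one_cyclic_centrally_nilpotent (p : nat) (B : finSkewBraceType) :
  prime p -> p.-nat #|B| -> one_cyclic B -> centrally_nilpotent B.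
Proof.
move=> p_pr pB cB.
have grow k : ideal_set (upper_central B k) != setT ->
    upper_central B k \proper upper_central B k.+1.
  move=> neqT; rewrite properE upper_central_sub /=.
  set Q := quo (upper_central B k).
  have Q_gt1 : 1 < #|{: Q}|.
    move: neqT; rewrite -subTset => /subsetPn[b _ bZ].
    apply/card_gt1P; exists (quo_proj _ b), sb_zero.
    by split=> //; apply: contraNneq bZ => /quo_proj_eq0.
  have [x] := centre_neq0 p_pr (pnat_quo (upper_central B k) pB)
    (one_cyclic_quo (upper_central B k) cB) Q_gt1.
  have [b ->] := quo_projS x => bZ b0.
  apply/subsetPn; exists b; first by rewrite inE.
  by apply: contraNN b0 => bk; apply/eqP; apply: coset_id.
have card_Z k : ideal_set (upper_central B k) != setT ->
    k < #|ideal_set (upper_central B k.+1)|.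
  elim: k => [|k IHk] neqT.
    by apply: leq_ltn_trans (proper_card (grow _ neqT)).
  apply: leq_ltn_trans (proper_card (grow _ neqT)); apply: IHk.
  apply: contraNneq neqT => eqT.
  by rewrite eqEsubset subsetT /= -eqT upper_central_sub.
exists #|B|; apply/eqP; apply: contraT => /card_Z.
by rewrite ltnNge max_card.
Qed.

Theorem theorem4p1 (p n : nat) (B : finSkewBraceType) :
  prime p -> #|B| = (p ^ n)%N ->
  cyclic [set: addg B] \/ cyclic [set: circg B] ->
  is_dedekind B /\ centrally_nilpotent B.
Proof.
move=> p_pr oB cB; have pB : p.-nat #|B| by rewrite oB pnatX pnat_id.
split; first exact: one_cyclic_dedekind p_pr pB cB.
exact: one_cyclic_centrally_nilpotent p_pr pB cB.
Qed.
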